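(* For every $1\leq p\leq2$ and every $n\in\mathbb{N}$, $$A_{p,1}(B_{\ell^n_1},\mathbb{C},1)=\frac{p}{n(p+2)}.$$
   Context: $B_{\ell^n_1}=\{z\in\mathbb{C}^n:\sum_{i=1}^n|z_i|<1\}$. A holomorphic $f:B_{\ell^n_1}\to\mathbb{C}$ is written $f(z)=\sum_{\alpha\in\mathbb{N}_0^n}x_\alpha(f)z^\alpha$, where $\mathbb{N}_0=\mathbb{N}\cup\{0\}$, with $x_0(f)=f(0)$, and $\|f\|_{B_{\ell^n_1}}=\sup_{z\in B_{\ell^n_1}}|f(z)|$. $A_{p,1}(B_{\ell^n_1},\mathbb{C},1)$, the arithmetic Bohr radius (with parameters $p$, $q=1$ and $\lambda=1$) of $B_{\ell^n_1}$ with respect to bounded holomorphic functions, is the supremum of $\frac1n\sum_{i=1}^n r_i$ over all $r=(r_1,\dots,r_n)\in\mathbb{R}^n$ with all $r_i\geq0$ such that $$|x_0(f)|^p+\sum_{m=1}^\infty\sum_{|\alpha|=m}|x_\alpha(f)|r^\alpha\leq\|f\|_{B_{\ell^n_1}}$$ for all bounded holomorphic $f:B_{\ell^n_1}\to\mathbb{C}$.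
   Formalization: The inequality defining the arithmetic Bohr radius is required only for holomorphic f with ‖f‖ ≤ 1, not all bounded f; for p > 1 the constant f = 2 would otherwise make no r admissible, and for p = 1 the two conditions agree by scaling. *)

(* Defs.v *)
From HB Require Import structures.
From mathcomp Require Import all_boot all_order all_algebra.
From mathcomp Require Import finmap.
From mathcomp Require Import complex.
From mathcomp Require Import all_classical all_reals all_analysis.
From mathcomp Require Import summability.

Set Implicit Arguments.
Unset Strict Implicit.
Unset Printing Implicit Defensive.

Import Order.TTheory GRing.Theory Num.Theory.
Import numFieldNormedType.Exports.

Local Open Scope classical_set_scope.
Local Open Scope ring_scope.

Notation multiindex n := {ffun 'I_n -> nat}.

Definition mindex0 (n : nat) : multiindex n := [ffun=> 0%N].

Definition mdegree (n : nat) (a : multiindex n) : nat := (\sum_(i < n) a i)%N.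

Definition monomial (K : comPzRingType) (n : nat) (z : 'rV[K]_n)
    (a : multiindex n) : K :=
  \prod_(i < n) z 0 i ^+ a i.

(* The next two definitions are used with [K := R[i]] only; functions are
   total, and only their values on [D] matter when [D] is open. *)

Definition holomorphic_on (K : numFieldType) (n : nat) (D : set 'rV[K]_n)
    (f : 'rV[K]_n -> K) : Prop :=
  forall z : 'rV[K]_n, D z -> differentiable f z.

(* f(z) is the unordered sum over all multi-indices of x_a z^a, i.e. the limit
   of the sums over finite sets of multi-indices. A function that is
   holomorphic on [l1_ball] below has exactly one such family [x] there. *)
Definition monomial_coefficients (K : numFieldType) (n : nat)
    (D : set 'rV[K]_n) (f : 'rV[K]_n -> K) (x : multiindex n -> K) : Prop :=
  forall z : 'rV[K]_n, D z ->
    partial_sum (fun a : multiindex n => x a * monomial z a) @ totally --> f z.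

Section BohrRadius.
Context {R : realType} {n : nat}.

(* [Normc.normc] is the modulus with values in R, whereas [`|z|] lives in
   R[i]. *)
Definition l1_ball : set 'rV[R[i]]_n :=
  [set z | \sum_(i < n) Normc.normc (z 0 i) < 1].

Definition sup_norm (f : 'rV[R[i]]_n -> R[i]) : \bar R :=
  ereal_sup [set (Normc.normc (f z))%:E | z in l1_ball].

Definition bohr_sum (p : R) (x : multiindex n -> R[i]) (r : 'rV[R]_n) : \bar R :=
  ((Normc.normc (x (mindex0 n)) `^ p)%:E +
   \sum_(1 <= m <oo)
     \esum_(a in [set a : multiindex n | mdegree a = m])
       (Normc.normc (x a) * monomial r a)%:E)%E.

(* The bounded functions are normalized by ||f|| <= 1: the inequality is not
   homogeneous in f when p > 1, and without the normalization no r would be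
   admissible, since the constant function 2 would require 2 `^ p <= 2. *)
Definition bohr_admissible (p : R) (r : 'rV[R]_n) : Prop :=
  (forall i, 0 <= r 0 i) /\
  forall (f : 'rV[R[i]]_n -> R[i]) (x : multiindex n -> R[i]),
    holomorphic_on l1_ball f -> monomial_coefficients l1_ball f x ->
    (sup_norm f <= 1)%E ->
    (bohr_sum p x r <= sup_norm f)%E.

End BohrRadius.

Definition arithmetic_bohr_radius (R : realType) (n : nat) (p : R) : \bar R :=
  ereal_sup [set ((\sum_(i < n) r 0 i) / n%:R)%:E
            | r in [set r : 'rV[R]_n | bohr_admissible p r]].

(* Main.v *)
Require Import Defs.
From mathcomp Require Import all_boot all_order all_algebra.
From mathcomp Require Import all_solvable all_field.
From mathcomp Require Import finmap complex.
From mathcomp Require Import ring lra.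
From mathcomp Require Import all_classical all_reals all_analysis.
From mathcomp Require Import summability.
Set Implicit Arguments.
Unset Strict Implicit.
Unset Printing Implicit Defensive.
Import Order.TTheory GRing.Theory Num.Theory.
Import numFieldNormedType.Exports.
Local Open Scope classical_set_scope.
Local Open Scope ring_scope.

(** For [n = 1] the coefficients of a function bounded by [M] on the disc satisfy
    [M |x_m| <= M^2 - |x_0|^2], and Moebius transforms with zero [a -> 1] show
    that this is sharp for the present problem; together they give the radius
    [p / (p + 2)].  In dimension [n] the problem collapses to this one at both
    ends.  If [r] is concentrated on one axis, only the coefficients of the slice
    of [f] along that axis contribute, so [r = (p / (p + 2), 0, ..., 0)] is
    admissible.  Conversely, for [f z = phi (z_1 + ... + z_n)] with [phi] a
    Moebius transform, the multinomial formula turns the Bohr sum of [f] at [r]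
    into that of [phi] at [r_1 + ... + r_n].

    The coefficient inequality is proved without integrals: Parseval's identity
    over the [N]-th roots of unity, applied to [P * (c + d X^m)] for a Taylor
    polynomial [P], bounds a lower triangular 2x2 Toeplitz matrix. *)

(** * Coefficients of bounded power series *)

Local Notation normc := Normc.normc.

(** ['X^N - 1] splits and is separable, so it has [N] distinct roots; among [N] distinct [N]-th
    roots of unity one is primitive. *)
Lemma prim_root_exists (C : numClosedFieldType) (N : nat) :
  (0 < N)%N -> exists z : C, N.-primitive_root z.
Proof.
move=> N_gt0; have [r] := closed_field_poly_normal ('X^N - 1 : {poly C}).
rewrite (monicP _) ?monicXnsubC // scale1r => Dp.
have /hasP[z _ zP] : has N.-primitive_root r; last by exists z.
apply: has_prim_root => //.
- by apply/allP=> z; rewrite -root_prod_XsubC -Dp.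
- by rewrite -separable_prod_XsubC -Dp separable_Xn_sub_1 // pnatr_eq0 -lt0n.
- by rewrite -ltnS -(size_prod_XsubC r id) -Dp size_XnsubC.
Qed.

(** Expanding the squares leaves power sums of [z ^+ k * z^* ^+ l], an [N]-th root of unity. They
    vanish unless this root is 1, which for [k, l < N] means [k = l]. *)
Lemma parseval_prim_root (C : numClosedFieldType) (N : nat) (z : C)
    (Q : {poly C}) : N.-primitive_root z -> (size Q <= N)%N ->
  \sum_(j < N) `|Q.[z ^+ j]| ^+ 2 = N%:R * \sum_(k < N) `|Q`_k| ^+ 2.
Proof.
move=> zP szQ.
have zN := prim_expr_order zP; have N_gt0 := prim_order_gt0 zP.
have z_norm : `|z| = 1.
  by apply/eqP; rewrite -(@pexpr_eq1 _ _ N) // -normrX zN normr1.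
have zz : z * z^* = 1 by rewrite -normCK z_norm expr1n.
pose u (k l : 'I_N) := z ^+ k * z^* ^+ l.
have sum_u k l : \sum_(j < N) u k l ^+ j = (k == l)%:R * N%:R.
  have [->|kl] := eqVneq k l.
    rewrite mul1r (eq_bigr (fun=> 1)) ?sumr_const ?card_ord // => j _.
    by rewrite /u -exprMn zz !expr1n.
  have u1 : u k l != 1.
    apply: contra kl => /eqP u1; suff: z ^+ k == z ^+ l.
      by rewrite (eq_prim_root_expr zP) !modn_small.
    by rewrite -[z ^+ l]mul1r -u1 -mulrA -exprMn [z^* * z]mulrC zz expr1n mulr1.
  apply: (mulfI (x := u k l - 1)); first by rewrite subr_eq0.
  rewrite -subrX1 /u exprMn -!exprM mulnC [(l * N)%N]mulnC !exprM -rmorphXn zN.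
  by rewrite rmorph1 !expr1n mulr1 subrr mul0r mulr0.
have Qz j : Q.[z ^+ j] = \sum_(k < N) Q`_k * (z ^+ k) ^+ j.
  rewrite (horner_coef_wide _ szQ); apply: eq_bigr => k _.
  by rewrite -!exprM mulnC.
pose F (k l : 'I_N) := Q`_k * (Q`_l)^*.
transitivity (\sum_(j < N) \sum_(k < N) \sum_(l < N) F k l * u k l ^+ j).
  apply: eq_bigr => j _; rewrite normCK Qz rmorph_sum mulr_suml.
  apply: eq_bigr => k _. rewrite big_distrr /=; apply: eq_bigr => l _.
  by rewrite rmorphM !rmorphXn mulrACA -exprMn.
rewrite exchange_big mulr_sumr; apply: eq_bigr => k _.
rewrite exchange_big (eq_bigr (fun l => F k l * ((k == l)%:R * N%:R))).
  rewrite (bigD1 k) //= eqxx mul1r big1 ?addr0 /F -?normCK 1?mulrC // => l lk.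
  by rewrite eq_sym (negPf lk) mul0r mulr0.
by move=> l _; rewrite -mulr_sumr sum_u.
Qed.

(** Sum [|P D|^2 <= M^2 |D|^2], with [D = c + d X^m], over the [N]-th roots of unity. Parseval
    evaluates both sides; on the left only the coefficients 0 and [m] of [P * D] are kept. *)
Lemma coef_poly_bound (C : numClosedFieldType) (P : {poly C}) (M : C) m c d :
  (0 < m)%N -> (forall w, `|w| = 1 -> `|P.[w]| <= M) ->
  `|c * P`_0| ^+ 2 + `|c * P`_m + d * P`_0| ^+ 2
    <= M ^+ 2 * (`|c| ^+ 2 + `|d| ^+ 2).
Proof.
(* [N] exceeds the degree of [P * D], as Parseval requires. *)
move=> m_gt0 PM; pose N := (size P + m.+1)%N.
have N_gt0 : (0 < N)%N by rewrite /N addnS.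
have [z zP] := prim_root_exists C N_gt0.
have mN : (m < N)%N by rewrite /N leq_addl.
pose D := c%:P + d *: 'X^m.
have PDE : P * D = c *: P + d *: (P * 'X^m).
  by rewrite mulrDr -scalerAr [P * _]mulrC mul_polyC.
have D0 : D`_0 = c by rewrite !coefE eqxx ltn_eqF // mulr0 addr0.
have Dm : D`_m = d by rewrite !coefE eqxx gtn_eqF // mulr1 add0r.
have szD : (size D <= m.+1)%N.
  rewrite (leq_trans (size_polyD _ _)) // geq_max.
  rewrite (leq_trans (size_polyC_leq1 _)) //=.
  by rewrite (leq_trans (size_scale_leq _ _)) // size_polyXn.
have szPD : (size (P * D)%R <= N)%N.
  rewrite (leq_trans (size_polyMleq _ _)) // /N -subn1 leq_subLR.
  by rewrite (leq_trans (leq_add (leqnn _) szD)) // leq_addl.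
pose i0 := Ordinal N_gt0; pose im := Ordinal mN.
have im0 : im != i0 by rewrite -val_eqE /= -lt0n.
rewrite -(ler_pM2l (x := N%:R)) ?ltr0n //.
apply: le_trans (_ : \sum_(j < N) `|(P * D).[z ^+ j]| ^+ 2 <= _).
  rewrite (parseval_prim_root zP szPD) ler_pM2l ?ltr0n //.
  rewrite (bigD1 i0) //= (bigD1 im) //= addrA -[leLHS]addr0 lerD //; last first.
    by apply: sumr_ge0 => k _; rewrite exprn_ge0.
  rewrite /= PDE !coefD !coefZ !coefMXn m_gt0 ltnn.
  by rewrite subnn mulr0 addr0.
apply: le_trans (_ : \sum_(j < N) M ^+ 2 * `|D.[z ^+ j]| ^+ 2 <= _).
  apply: ler_sum => j _; rewrite hornerM normrM exprMn ler_wpM2r ?exprn_ge0 //.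
  have Pj : `|P.[z ^+ j]| <= M.
    apply: PM; apply/eqP; rewrite -(@pexpr_eq1 _ _ N) // -normrX exprAC.
    by rewrite (prim_expr_order zP) expr1n normr1.
  by rewrite ler_pXn2r ?nnegrE // (le_trans _ Pj).
rewrite -mulr_sumr (parseval_prim_root zP (leq_trans szD mN)) mulrCA.
rewrite (bigD1 i0) //= (bigD1 im) //= D0 Dm big1 ?addr0 // => k.
rewrite -!val_eqE /= => /andP[k0 km].
by rewrite !coefE (negPf k0) (negPf km) mulr0 addr0 normr0 expr0n.
Qed.

(** The hypothesis is what [coef_poly_bound] gives for [c = s], [d = t * x_0^* * x_m], where
    [a = |x_0|] and [b = |x_m|]. *)
Lemma schwarz_pick_algebra (R : realFieldType) (a b M : R) :
  0 < M -> 0 <= a -> a <= M -> 0 <= b ->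
  (forall s t, s ^+ 2 * a ^+ 2 + (s + t * a ^+ 2) ^+ 2 * b ^+ 2
     <= M ^+ 2 * (s ^+ 2 + t ^+ 2 * a ^+ 2 * b ^+ 2)) ->
  M * b + a ^+ 2 <= M ^+ 2.
Proof.
move=> M_gt0 a_ge0 aM b_ge0 H.
(* [s = M^2 - a^2, t = 1] suffices, except when it degenerates to [s = 0]. *)
move: aM; rewrite le_eqVlt => /predU1P[aM|aM].
  (* For [a = M] this choice reads [M^2 + 4 b^2 <= M^2 + b^2], so [b = 0]. *)
  subst a. have := H 1 (1 / M ^+ 2).
  rewrite (_ : 1 + _ = 2); last by field; lra.
  rewrite (_ : (1 / _) ^+ 2 * _ = M ^- 2); last by field; lra.
  rewrite mulrDr mulrA divff ?expf_neq0; try lra.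
  move=> h; suff -> : b = 0 by lra.
  nra.
pose D := M ^+ 2 - a ^+ 2.
have D_gt0 : 0 < D by rewrite /D; nra.
have := H D 1; rewrite /D => h.
(* Since [D + a^2 = M^2], collecting the terms in [b] leaves the factor [D] on both sides. *)
have {h} : D * (M ^+ 2 * b ^+ 2) <= D * D ^+ 2.
  rewrite /D; lra.
rewrite ler_pM2l // -exprMn ler_sqr ?nnegrE //; [rewrite /D; lra|nra|lra].
Qed.

Lemma normcE (R : realType) (x : R[i]) : (normc x)%:C%C = `|x|.
Proof. by case: x => a b; rewrite normc_def. Qed.

Lemma normc_ge0 (R : realType) (x : R[i]) : 0 <= normc x.
Proof. by case: x => a b; exact: sqrtr_ge0. Qed.

Lemma normcX (R : realType) (x : R[i]) k : normc (x ^+ k) = normc x ^+ k.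
Proof. by apply: (@complexI R); rewrite rmorphXn /= !normcE normrX. Qed.

Lemma normc_real (R : realType) (x : R) : normc x%:C%C = `|x|.
Proof. by rewrite /normc /= expr0n addr0 sqrtr_sqr. Qed.

Lemma ler_normcB (R : realType) (x y z : R[i]) :
  normc (x - z) <= normc (x - y) + normc (y - z).
Proof. by rewrite -lecR rmorphD /= !normcE -[x - z](subrKA y) ler_normD. Qed.

Lemma ler_normc_sum (R : realType) (I : Type) (r : seq I) (P : pred I)
    (F : I -> R[i]) :
  normc (\sum_(i <- r | P i) F i) <= \sum_(i <- r | P i) normc (F i).
Proof. by rewrite -lecR rmorph_sum /= normcE ler_norm_sum. Qed.

(** Positive elements of [R[i]] are real, so real tolerances suffice. *)
Lemma cvg_normcP (R : realType) (T : Type) (F : set_system T) (FF : Filter F)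
    (u : T -> (R[i] : numFieldType)) (l : (R[i] : numFieldType)) :
  u @ F --> l <-> forall e : R, 0 < e -> \forall x \near F, normc (l - u x) < e.
Proof.
split=> [/cvgrPdist_lt H e e0|H].
  have /H : 0 < e%:C%C by rewrite ltcR.
  by apply: filterS => x; rewrite -normcE ltcR.
apply/cvgrPdist_lt => e e0.
have eE : e = (complex.Re e)%:C%C by rewrite RRe_real // gtr0_real.
have /H : 0 < complex.Re e by rewrite -ltcR -eE.
by apply: filterS => x; rewrite eE -normcE ltcR.
Qed.

Lemma sum_geometric_le (R : realFieldType) (q : R) (K L : nat) :
  0 <= q -> q < 1 -> \sum_(K <= k < L) q ^+ k <= q ^+ K / (1 - q).
Proof.
move=> q0 q1; rewrite ler_pdivlMr ?subr_gt0 // mulr_suml.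
have [KL|LK] := leqP K L; last by rewrite big_geq ?exprn_ge0 // ltnW.
rewrite (telescope_sumr_eq (fun k => - q ^+ k)) // => [|k _].
  by rewrite opprK addrC gerBl exprn_ge0.
by rewrite exprS; ring.
Qed.

(** Limits at 1 are taken below by first writing the inequality as one about a polynomial. *)
Lemma horner1_le (R : realType) (p : {poly R}) (y : R) :
  (forall r, 0 < r -> r < 1 -> p.[r] <= y) -> p.[1] <= y.
Proof.
move=> py; have /cvg_at_left_filter p1 : {for 1, continuous (horner p)}.
  exact: continuous_horner.
apply: (cvgr_to_le p1); near=> r; apply: py.
  by near: r; exact: nbhs_left_gt.
by near: r; exact: nbhs_left_lt.
Unshelve. all: by end_near. Qed.

(** * From polynomials to bounded power series on the disc *)

Section OneVariable.
Context {R : realType} (a : nat -> R[i]) (g : R[i] -> R[i]) (M : R).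

Definition psum (w : R[i]) (K : nat) : R[i] := \sum_(0 <= k < K) a k * w ^+ k.

Hypothesis psum_cvg : forall w, normc w < 1 -> forall e : R, 0 < e ->
  \forall K \near \oo, normc (g w - psum w K) < e.

(** The terms of a convergent series are bounded: from some [K] on, consecutive partial sums at [s]
    are both within 1 of [g s], so the term between them is below 2. The earlier terms are bounded
    by their sum. *)
Lemma coef_geometric_bound (s : R) : 0 < s -> s < 1 ->
  exists2 B : R, 0 < B & forall k, normc (a k) * s ^+ k <= B.
Proof.
move=> s0 s1.
have sE : normc s%:C%C = s by rewrite normc_real gtr0_norm.
have /psum_cvg /(_ 1 ltr01) [K _ KP] : normc s%:C%C < 1 by rewrite sE.
have B0 : 0 <= \sum_(k < K) normc (a k) * s ^+ k.
  by apply: sumr_ge0 => k _; rewrite mulr_ge0 ?normc_ge0 ?exprn_ge0 // ltW.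
exists (\sum_(k < K) normc (a k) * s ^+ k + 2); first lra.
move=> k; have [kK|Kk] := ltnP k K.
  rewrite (bigD1 (Ordinal kK)) //= -addrA lerDl addr_ge0 //.
  by apply: sumr_ge0 => j _; rewrite mulr_ge0 ?normc_ge0 ?exprn_ge0 // ltW.
have := KP k Kk; have := KP k.+1 (leqW Kk) => /= h1 h2.
have := ler_normcB (psum s%:C%C k.+1) (g s%:C%C) (psum s%:C%C k).
have -> : psum s%:C%C k.+1 - psum s%:C%C k = a k * s%:C%C ^+ k.
  by rewrite /psum big_nat_recr //= addrAC subrr add0r.
rewrite Normc.normcM normcX sE -[_ - g _]opprB normcN; lra.
Qed.

Hypothesis g_le : forall w, normc w < 1 -> normc (g w) <= M.

(** On the circle of radius [r] the tail is dominated by a geometric series of ratio [r / s], with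
    [r < s < 1], which makes the convergence uniform there. *)
Lemma psum_near_bound (r e : R) : 0 < r -> r < 1 -> 0 < e ->
  \forall K \near \oo, forall w, normc w = r -> normc (psum w K) <= M + e.
Proof.
move=> r0 r1 e0; pose s := (r + 1) / 2.
have s0 : 0 < s by rewrite /s; lra.
have s1 : s < 1 by rewrite /s; lra.
have [B B0 aB] := coef_geometric_bound s0 s1.
pose q := r / s.
have q0 : 0 <= q by rewrite divr_ge0 // ltW.
have q1 : q < 1 by rewrite ltr_pdivrMr // /s; lra.
have qs : q * s = r by rewrite divfK // gt_eqF.
have : (fun K => B * (q ^+ K / (1 - q))) @ \oo --> B * (0 / (1 - q)).
  apply: cvgMr; apply: cvgMl; apply: cvg_expr; by rewrite ger0_norm.
rewrite mul0r mulr0 => /cvgr_lt /(_ _ e0); apply: filterS => K tailK w wr.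
(* [K] is already fixed independently of [w]. Pointwise convergence at [w] is used only at a later
   index [L'], and costs an arbitrary [d]. *)
apply/ler_addgt0Pr => d d0.
have /psum_cvg /(_ _ d0) [L _ LP] : normc w < 1 by rewrite wr.
pose L' := maxn K L.
have := LP L' (leq_maxr _ _) => /= hL.
have hK : normc (psum w L' - psum w K) <= B * (q ^+ K / (1 - q)).
  rewrite /psum (big_cat_nat (n := K) (p := L')) ?leq_maxl //= addrAC subrr add0r.
  apply: le_trans (ler_normc_sum _ _ _) _.
  apply: le_trans (_ : \sum_(K <= k < L') B * q ^+ k <= _).
    apply: ler_sum => k _; rewrite Normc.normcM normcX wr -qs exprMn mulrCA mulrC.
    by rewrite ler_wpM2r ?exprn_ge0.
  by rewrite -mulr_sumr ler_wpM2l ?sum_geometric_le // ltW.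
have := ler_normcB (psum w K) (psum w L') 0.
have := ler_normcB (psum w L') (g w) 0.
have : normc w < 1 by rewrite wr.
move/g_le; rewrite !subr0.
rewrite -normcN opprB in hL; rewrite -normcN opprB in hK.
lra.
Qed.

(** Dilating by [r < 1] and truncating gives a polynomial bounded by [M + e] on the unit circle, to
    which the polynomial bound applies; then [r] tends to 1 and [e] to 0. *)
Lemma schwarz_pick_coef (m : nat) : 0 < M -> (0 < m)%N ->
  M * normc (a m) + normc (a 0%N) ^+ 2 <= M ^+ 2.
Proof.
move=> M0 m0.
have bound r e : 0 < r -> r < 1 -> 0 < e ->
    (M + e) * (normc (a m) * r ^+ m) + normc (a 0%N) ^+ 2 <= (M + e) ^+ 2.
  move=> r0 r1 e0.
  have [K _ /(_ (maxn K m.+1))] := psum_near_bound r0 r1 e0.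
  rewrite /= leq_maxl => /(_ isT); set L := maxn _ _ => PL.
  have mL : (m < L)%N by rewrite leq_maxr.
  pose P := \poly_(k < L) (a k * r%:C%C ^+ k).
  have P0 : P`_0 = a 0%N by rewrite coef_poly (leq_ltn_trans _ mL) // mulr1.
  have Pm : P`_m = a m * r%:C%C ^+ m by rewrite coef_poly mL.
  have PM w : `|w| = 1 -> `|P.[w]| <= (M + e)%:C%C.
    rewrite -normcE => /complexI w1; rewrite -normcE lecR.
    have -> : P.[w] = psum (r%:C%C * w) L.
      rewrite horner_poly /psum big_mkord; apply: eq_bigr => k _.
      by rewrite exprMn mulrA.
    by apply: PL; rewrite Normc.normcM w1 mulr1 normc_real gtr0_norm.
  have coefs c d : normc (c * a 0%N) ^+ 2 +
      normc (c * (a m * r%:C%C ^+ m) + d * a 0%N) ^+ 2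
      <= (M + e) ^+ 2 * (normc c ^+ 2 + normc d ^+ 2).
    rewrite -lecR !(rmorphD, rmorphM, rmorphXn) /= !normcE -P0 -Pm.
    by have := coef_poly_bound c d m0 PM; rewrite !expr2 rmorphD.
  have -> : normc (a m) * r ^+ m = normc (a m * r%:C%C ^+ m).
    by rewrite Normc.normcM normcX normc_real gtr0_norm.
  set b := a m * _ in coefs *.
  apply: schwarz_pick_algebra => //; rewrite ?normc_ge0 ?addr_gt0 //.
    (* The choice [c = 0], [d = 1] yields [|a 0| <= M + e]. *)
    have := coefs 0 1; rewrite !mul0r !Normc.normc0 !mul1r add0r Normc.normc1.
    rewrite expr0n /= !add0r expr1n mulr1 ler_sqr ?nnegrE ?normc_ge0 //.
    by rewrite addr_ge0 // ltW.
  (* The conjugate makes [d * a 0] a real multiple of [b], so that it adds up with [c * b] without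
     loss from phases. *)
  move=> s t; have := coefs s%:C%C (t%:C%C * ((a 0%N)^* * b)).
  set A := normc (a 0%N).
  have -> : s%:C%C * b + t%:C%C * ((a 0%N)^* * b) * a 0%N
      = (s + t * A ^+ 2)%:C%C * b.
    rewrite rmorphD rmorphM rmorphXn /= normcE normCK; ring.
  have -> : normc (t%:C%C * ((a 0%N)^* * b)) = `|t| * (A * normc b).
    rewrite !Normc.normcM normc_real; congr (_ * (_ * _)).
    by apply: (@complexI R); rewrite !normcE norm_conjC.
  by rewrite !Normc.normcM !normc_real !exprMn !real_normK ?num_real // -/A !mulrA.
(* Setting [e = 1 - r] merges both limits into one, for a polynomial in [r]. *)
pose p := ((M + 1)%:P - 'X) * (normc (a m) *: 'X^m) + (normc (a 0%N) ^+ 2)%:P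
  - ((M + 1)%:P - 'X) ^+ 2.
have pE r : p.[r] = (M + (1 - r)) * (normc (a m) * r ^+ m) + normc (a 0%N) ^+ 2
    - (M + (1 - r)) ^+ 2.
  by rewrite /p !hornerE -addrA.
rewrite -subr_le0; have -> : M * normc (a m) + normc (a 0%N) ^+ 2 - M ^+ 2 = p.[1].
  by rewrite pE subrr addr0 expr1n mulr1.
apply: horner1_le => r r0 r1; rewrite pE subr_le0.
by apply: bound => //; rewrite subr_gt0.
Qed.
End OneVariable.

(** * Admissible points on an axis *)

(** For [p > 1] this is Young's inequality for the product [a * 1], multiplied by [p]. *)
Lemma bernoulli_powR (R : realType) (a p : R) :
  0 <= a -> 1 <= p -> 1 + p * (a - 1) <= a `^ p.
Proof.
move=> a0; rewrite le_eqVlt => /predU1P[<-|p1].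
  by rewrite powRr1 // mul1r addrC subrK.
have p0 : 0 < p by lra.
have q0 : 0 < (1 - p^-1)^-1 by rewrite invr_gt0 subr_gt0 invf_lt1.
have := conjugate_powR a0 ler01 p0 q0.
rewrite invrK addrC subrK mulr1 powR1 mul1r => /(_ erefl).
rewrite -(ler_pM2l p0) mulrDr mulrBr mulrCA divff ?gt_eqF // !mulr1; lra.
Qed.

(** Bernoulli for the base [t^p] and the exponent [2 / p >= 1], whose power is [t^2]. *)
Lemma powR_le_parabola (R : realType) (t p : R) :
  0 <= t -> 1 <= p -> p <= 2 -> t `^ p <= 1 + p / 2 * (t ^+ 2 - 1).
Proof.
move=> t0 p1 p2; have p0 : 0 < p by lra.
have : 1 <= 2 / p by rewrite ler_pdivlMr // mul1r.
move/(bernoulli_powR (powR_ge0 t p)); rewrite -powRrM (mulrC p) divfK ?gt_eqF //.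
rewrite powR_mulrn // -(ler_pM2l (x := p / 2)) ?divr_gt0 // => h.
have e : p / 2 * (1 + (t `^ p - 1) * (2 / p)) = p / 2 + (t `^ p - 1).
  by field; rewrite gt_eqF.
lra.
Qed.

(** The factor [p / 2] will be the sum of [s^m] over [m >= 1] for [s = p / (p + 2)]. With
    [t = A / M], [M <= 1] gives [A^p <= M t^p], and what remains is [M] times the parabola bound. *)
Lemma bohr_inequality_real (R : realType) (p A M : R) :
  1 <= p -> p <= 2 -> 0 <= A -> A <= M -> 0 < M -> M <= 1 ->
  A `^ p + (M ^+ 2 - A ^+ 2) / M * (p / 2) <= M.
Proof.
move=> p1 p2 A0 AM M0 M1; pose t := A / M.
have t0 : 0 <= t by rewrite divr_ge0 // ltW.
have AE : A = M * t by rewrite /t mulrCA divff ?mulr1 ?gt_eqF.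
have -> : (M ^+ 2 - A ^+ 2) / M = M * (1 - t ^+ 2).
  by rewrite AE; field; rewrite gt_eqF.
have := powR_le_parabola t0 p1 p2.
rewrite -(ler_pM2l M0) => h.
have : A `^ p <= M * t `^ p by rewrite AE ge1r_powRZ // M0.
lra.
Qed.

Section Axis.
Context {n : nat} (i0 : 'I_n).

Definition axis_index (k : nat) : multiindex n :=
  [ffun i => if i == i0 then k else 0%N].

Definition axis_point (K : comPzRingType) (w : K) : 'rV[K]_n :=
  \row_i (if i == i0 then w else 0).

Lemma axis_index0 : axis_index 0 = mindex0 n.
Proof. by apply/ffunP => i; rewrite !ffunE; case: ifP. Qed.

Lemma axis_index_inj : injective axis_index.
Proof. by move=> k l /ffunP /(_ i0); rewrite !ffunE eqxx. Qed.

Lemma mdegree_axis_index k : mdegree (axis_index k) = k.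
Proof.
rewrite /mdegree (bigD1 i0) //= ffunE eqxx big1 ?addn0 // => i /negPf i_i0.
by rewrite ffunE i_i0.
Qed.

(** Used with [h] the modulus, for membership in the ball, and with [h] the identity, for the sum of
    the radii. *)
Lemma sum_axis_point (V : nmodType) (K : comPzRingType) (h : K -> V) (w : K) :
  h 0 = 0 -> \sum_i h (axis_point w 0 i) = h w.
Proof.
move=> h0; rewrite (bigD1 i0) //= mxE eqxx big1 ?addr0 // => i /negPf i_i0.
by rewrite mxE i_i0.
Qed.

Lemma monomial_axis_point (K : comPzRingType) (w : K) (a : multiindex n) :
  monomial (axis_point w) a = if a == axis_index (a i0) then w ^+ a i0 else 0.
Proof.
rewrite /monomial; case: eqP => [aE|a_neq].
  rewrite (bigD1 i0) //= mxE eqxx big1 ?mulr1 // => i i_i0.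
  by rewrite aE ffunE (negPf i_i0) expr0.
have [i /andP[i_i0 ai]] : exists i, (i != i0) && (a i != 0%N).
  apply/existsP; apply: contra_notT a_neq => /existsPn H.
  apply/ffunP => i; rewrite ffunE; case: eqP => [-> //|/eqP i_i0].
  by have := H i; rewrite i_i0 /= negbK => /eqP.
by rewrite (bigD1 i) //= mxE (negPf i_i0) expr0n (negPf ai) mul0r.
Qed.

Lemma monomial_axis_index (K : comPzRingType) (w : K) k :
  monomial (axis_point w) (axis_index k) = w ^+ k.
Proof. by rewrite monomial_axis_point !ffunE !eqxx. Qed.

(** Unordered summability gives a finite set [A] beyond which all sums are close to the value. Once
    [K] exceeds all exponents at [i0] in [A], the union of [A] with the first [K] axis indices adds
    to these only terms that vanish on the axis. *)
Lemma psum_axis_cvg (R : realType) (D : set 'rV[R[i]]_n) f x (w : R[i]) (e : R) :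
  monomial_coefficients D f x -> D (axis_point w) -> 0 < e ->
  \forall K \near \oo,
    normc (f (axis_point w) - psum (fun k => x (axis_index k)) w K) < e.
Proof.
move=> fx /fx fw e0.
have [A _ AP] := (cvg_normcP (totally_filter (I := multiindex n)) _ _).1 fw e e0.
exists (\max_(a <- A) (a i0).+1)%N => // K /= AK.
pose E := [fset axis_index k | k in iota 0 K]%fset.
have := AP (A `|` E)%fset (fsubsetUl _ _).
congr (normc (_ - _) < e); rewrite /partial_sum.
rewrite -(big_seq_fsetE _ _ xpredT (fun a => x a * monomial (axis_point w) a)) /=.
rewrite -(@big_fset_incl _ _ _ _ E) ?fsubsetUr // => [|a].
  rewrite big_imfset /= => [|k l _ _]; last exact: axis_index_inj.
  rewrite (perm_big (iota 0 K)) /=; last first.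
    by rewrite undup_id ?iota_uniq.
  rewrite /psum /index_iota subn0; apply: eq_bigr => k _.
  by rewrite monomial_axis_index.
rewrite in_fsetU => /orP[aA|-> //] aE.
rewrite monomial_axis_point ifF ?mulr0 //.
apply: contraNF aE => /eqP ->; apply/imfsetP; exists (a i0) => //=.
rewrite mem_iota add0n /=; apply: leq_trans AK.
exact: (leq_bigmax_seq (F := fun a : multiindex n => (a i0).+1)).
Qed.

End Axis.

Section AxisAdmissible.
Context {R : realType} {n : nat} (i0 : 'I_n).

(** Exactly one multi-index of degree [m] lies on the axis; all others contribute 0. *)
Lemma esum_axis_point (c : multiindex n -> R) (s : R) (m : nat) :
  (forall a, 0 <= c a) -> 0 <= s ->
  \esum_(a in [set a : multiindex n | mdegree a = m])
    (c a * monomial (axis_point i0 s) a)%:E = (c (axis_index i0 m) * s ^+ m)%:E.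
Proof.
move=> c0 s0; pose G a := (c a * monomial (axis_point i0 s) a)%:E.
have GE : G (axis_index i0 m) = (c (axis_index i0 m) * s ^+ m)%:E.
  by rewrite /G monomial_axis_index.
rewrite -[RHS]GE -[RHS]esum_set1; last by rewrite GE lee_fin mulr_ge0 ?exprn_ge0.
rewrite esum_mkcond [RHS]esum_mkcond; apply: eq_esum => a _.
case: ifPn; rewrite (inE, notin_setE) /= => am; case: ifPn => //.
  rewrite notin_setE /= => a_neq; rewrite monomial_axis_point ifF ?mulr0 //.
  apply/eqP => aE; apply: a_neq; rewrite aE; congr axis_index.
  by rewrite -[LHS](mdegree_axis_index i0) -aE.
by rewrite inE /= => aE; case: am; rewrite aE mdegree_axis_index.
Qed.

(** The slice of [f] along the axis is bounded by [M] on the disc, so its coefficients obey the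
    one-variable inequality. [M] is any positive bound, not the norm itself, to cover functions of
    norm 0. *)
Lemma bohr_sum_axis_point_le (p M : R) f x :
  1 <= p -> p <= 2 -> 0 < M -> M <= 1 ->
  monomial_coefficients l1_ball f x -> (sup_norm f <= M%:E)%E ->
  (bohr_sum p x (axis_point i0 (p / (p + 2))) <= M%:E)%E.
Proof.
move=> p1 p2 M0 M1 fx fM; set s := p / (p + 2).
have s0 : 0 <= s by rewrite divr_ge0 //; lra.
have s1 : s < 1 by rewrite ltr_pdivrMr; lra.
have sE : s / (1 - s) = p / 2 by rewrite /s; field; lra.
have ball w : normc w < 1 -> l1_ball (axis_point i0 w : 'rV[R[i]]_n).
  by rewrite /l1_ball /= sum_axis_point // Normc.normc0.
have f_le w : normc w < 1 -> normc (f (axis_point i0 w)) <= M.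
  move=> /ball w1; rewrite -lee_fin; apply: le_trans fM.
  by apply: ereal_sup_ubound; exists (axis_point i0 w).
have cvg w : normc w < 1 -> forall e : R, 0 < e -> \forall K \near \oo,
    normc (f (axis_point i0 w) - psum (fun k => x (axis_index i0 k)) w K) < e.
  by move=> /ball w1 e; apply: (psum_axis_cvg fx).
have := schwarz_pick_coef cvg f_le; rewrite axis_index0.
set A := normc (x (mindex0 n)); set C := (M ^+ 2 - A ^+ 2) / M => SP.
have A0 : 0 <= A by exact: normc_ge0.
have xC m : (0 < m)%N -> normc (x (axis_index i0 m)) <= C.
  by move=> m0; rewrite ler_pdivlMr // mulrC lerBrDr SP.
have AM : A <= M.
  rewrite -ler_sqr ?nnegrE ?(ltW M0) //; apply: le_trans (SP 1%N M0 isT).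
  by rewrite lerDr mulr_ge0 ?normc_ge0 // ltW.
have C0 : 0 <= C by rewrite (le_trans (normc_ge0 _) (xC 1%N isT)).
apply: le_trans (_ : (A `^ p)%:E + (C * (p / 2))%:E <= _)%E; last first.
  by rewrite -EFinD lee_fin bohr_inequality_real.
apply: leeD2l; apply: lime_le.
  apply: is_cvg_nneseries => m _ _; apply: esum_ge0 => a _.
  rewrite lee_fin mulr_ge0 ?normc_ge0 // prodr_ge0 // => i _.
  by rewrite exprn_ge0 // mxE; case: ifP.
near=> K; rewrite (eq_bigr (fun m => (normc (x (axis_index i0 m)) * s ^+ m)%:E)).
  rewrite sumEFin lee_fin -sE.
  apply: le_trans (_ : \sum_(1 <= m < K) C * s ^+ m <= _).
    rewrite big_nat [leRHS]big_nat; apply: ler_sum => m /andP[m1 _].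
    by rewrite ler_wpM2r ?exprn_ge0 // xC.
  by rewrite -mulr_sumr ler_wpM2l // -[in leRHS](expr1 s) sum_geometric_le.
move=> m _; apply: (esum_axis_point (c := fun a => normc (x a))) => // a.
exact: normc_ge0.
Unshelve. all: by end_near. Qed.

Lemma sup_norm_ge0 (f : 'rV[R[i]]_n -> R[i]) : (0 <= sup_norm f)%E.
Proof.
apply: le_ereal_sup_tmp; exists (normc (f (axis_point i0 0)))%:E.
  exists (axis_point i0 0) => //.
  by rewrite /l1_ball /= sum_axis_point ?Normc.normc0.
by rewrite lee_fin normc_ge0.
Qed.

Lemma axis_point_admissible (p : R) : 1 <= p -> p <= 2 ->
  bohr_admissible p (axis_point i0 (p / (p + 2))).
Proof.
move=> p1 p2; split=> [i|f x _ fx f1].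
  by rewrite mxE; case: ifP => // _; rewrite divr_ge0 //; lra.
have := sup_norm_ge0 f; case E: (sup_norm f) => [s| |] //; last by rewrite E in f1.
rewrite lee_fin le_eqVlt => /predU1P[s0|s0].
  (* For norm 0 the bound is applied with arbitrarily small positive [M], kept below 1. *)
  subst s; apply/lee_addgt0Pr => e e0.
  have m0 : 0 < Num.min e 1 by rewrite lt_min e0 ltr01.
  apply: le_trans (bohr_sum_axis_point_le p1 p2 m0 _ fx _) _.
  - by rewrite ge_min lexx orbT.
  - by rewrite E lee_fin ltW.
  - by rewrite add0e lee_fin ge_min lexx.
apply: (bohr_sum_axis_point_le p1 p2 s0 _ fx); last by rewrite E.
by rewrite -lee_fin -E.
Qed.

End AxisAdmissible.

(** * Power series in the sum of the coordinates *)

Lemma sum_fset_in (I : choiceType) (V : nmodType) (A D : {fset I}) (F : I -> V) :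
  (A `<=` D)%fset -> \sum_(a <- D | a \in A) F a = \sum_(a <- A) F a.
Proof.
move=> AD; rewrite big_mkcond [RHS]big_seq [RHS]big_mkcond /=.
by rewrite (big_fset_incl _ AD) // => a _ /negPf ->.
Qed.

Section SymmetricSeries.
Context {n : nat}.

(** A function [t] is a word of length [k] in the variables, as produced by expanding a [k]-th
    power; this is the exponent of its monomial. *)
Definition count_index (k : nat) (t : {ffun 'I_k -> 'I_n}) : multiindex n :=
  [ffun i => #|[pred j | t j == i]|].

Definition level_indices (k : nat) : {fset multiindex n} :=
  [fset count_index t | t in {ffun 'I_k -> 'I_n}]%fset.

(* The multinomial coefficient of [a], as the number of words of length
   [mdegree a] with letter counts [a]. *)
Definition multinom (a : multiindex n) : nat :=
  #|[pred t : {ffun 'I_(mdegree a) -> 'I_n} | count_index t == a]|.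

Lemma mdegree_count_index k (t : {ffun 'I_k -> 'I_n}) :
  mdegree (count_index t) = k.
Proof.
rewrite /mdegree -[RHS]card_ord -[RHS]sum1_card (partition_big t xpredT) //=.
apply: eq_bigr => i _; rewrite ffunE -sum1_card.
by apply: eq_bigl => j; rewrite inE.
Qed.

Lemma mdegree_level_indices k a : a \in level_indices k -> mdegree a = k.
Proof. by case/imfsetP => t _ ->; exact: mdegree_count_index. Qed.

(** Allows sums over arbitrary finite sets of indices to be cut down to [indices_below]. *)
Lemma multinom_eq0 a : a \notin level_indices (mdegree a) -> multinom a = 0%N.
Proof.
move=> aL; apply/eq_card0 => t; rewrite !inE.
by apply: contraNF aL => /eqP ta; apply/imfsetP; exists t.
Qed.

Lemma monomial_count_index (K : comPzRingType) (z : 'rV[K]_n) k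
    (t : {ffun 'I_k -> 'I_n}) :
  monomial z (count_index t) = \prod_j z 0 (t j).
Proof.
rewrite (partition_big t xpredT) //=; apply: eq_bigr => i _.
rewrite ffunE -prodr_const; apply: eq_big => [j|j]; first by rewrite inE.
by rewrite inE => /eqP ->.
Qed.

(** Distributing the power gives a sum over words, which are then grouped by letter counts. *)
Lemma multinomial_formula (K : comNzRingType) (z : 'rV[K]_n) (k : nat) :
  \sum_(a <- level_indices k) (multinom a)%:R * monomial z a
  = (\sum_i z 0 i) ^+ k.
Proof.
rewrite -[k in RHS]card_ord -prodr_const.
rewrite (bigA_distr_bigA (fun (j : 'I_k) (i : 'I_n) => z 0 i)) /=.
transitivity (\sum_(a <- level_indices k)
    \sum_(t : {ffun 'I_k -> 'I_n} | count_index t == a) monomial z a).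
  rewrite big_seq [RHS]big_seq; apply: eq_bigr => a /mdegree_level_indices ak.
  rewrite sumr_const mulr_natl; congr (_ *+ _).
  (* The words in [multinom] have length [mdegree a]; eliminating the equality identifies the two
     types of words. *)
  rewrite /multinom; case: _ / ak; apply: eq_card => t.
  by rewrite !inE.
rewrite (exchange_big_dep xpredT) //=; apply: eq_bigr => t _.
rewrite -monomial_count_index.
under eq_bigl do rewrite eq_sym.
rewrite (fbig_pred1_inj (k := id)) //.
by apply/imfsetP; exists t.
Qed.
Definition indices_below (K : nat) : {fset multiindex n} :=
  (\bigcup_(k <- [fset k in iota 0 K]) level_indices k)%fset.

Lemma level_indices_below k K a :
  a \in level_indices k -> (k < K)%N -> a \in indices_below K.
Proof.
move=> ak kK; apply/bigfcupP; exists k => //.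
by rewrite andbT !inE /= mem_iota.
Qed.

Lemma indices_belowS K L : (K <= L)%N -> (indices_below K `<=` indices_below L)%fset.
Proof.
move=> KL; apply/fsubsetP => a /bigfcupP[k]; rewrite andbT !inE /= mem_iota add0n.
by move=> kK ak; apply: level_indices_below ak _; apply: leq_trans KL.
Qed.

Lemma sum_indices_below (V : nmodType) (F : multiindex n -> V) K :
  \sum_(a <- indices_below K) F a
  = \sum_(0 <= k < K) \sum_(a <- level_indices k) F a.
Proof.
rewrite partition_disjoint_bigfcup => [|k l _ _ kl].
  by rewrite big_imfset //= undup_id ?iota_uniq // /index_iota subn0.
apply/fdisjointP => a /mdegree_level_indices ak.
by apply: contra kl => /mdegree_level_indices <-; rewrite ak.
Qed.

Lemma sum_multinomial_series (K : comNzRingType) (c : nat -> K) (z : 'rV[K]_n) N :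
  \sum_(a <- indices_below N) c (mdegree a) * (multinom a)%:R * monomial z a
  = \sum_(0 <= k < N) c k * (\sum_i z 0 i) ^+ k.
Proof.
rewrite sum_indices_below; apply: eq_bigr => k _.
rewrite -multinomial_formula mulr_sumr big_seq [RHS]big_seq.
by apply: eq_bigr => a /mdegree_level_indices ->; rewrite mulrA.
Qed.

Lemma normc_monomial (R : realType) (z : 'rV[R[i]]_n) a :
  normc (monomial z a) = monomial (\row_i normc (z 0 i)) a.
Proof.
apply: (@complexI R); rewrite rmorph_prod /= normcE normr_prod.
by apply: eq_bigr => i _; rewrite mxE rmorphXn /= normcE normrX.
Qed.

Lemma normc_nat (R : realType) k : normc (k%:R : R[i]) = k%:R.
Proof. by apply: (@complexI R); rewrite normcE normr_nat rmorph_nat. Qed.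

(** By the multinomial formula at the moduli [|z_i|], the terms of degree at least [K] have total
    modulus at most [s^K / (1 - s)]. Any finite [B] containing [indices_below K] is thus close to a
    full sum up to some degree [L], itself close to [g w]. *)
Lemma symmetric_monomial_coefficients (R : realType) (b : nat -> R[i])
    (g : R[i] -> R[i]) :
  (forall k, normc (b k) <= 1) ->
  (forall w, normc w < 1 -> forall e : R, 0 < e ->
    \forall K \near \oo, normc (g w - psum b w K) < e) ->
  monomial_coefficients l1_ball (fun z : 'rV[R[i]]_n => g (\sum_i z 0 i))
    (fun a => b (mdegree a) * (multinom a)%:R).
Proof.
move=> b1 gP z; rewrite /l1_ball /=; set s := \sum_i normc (z 0 i) => s1.
have s0 : 0 <= s by apply: sumr_ge0 => i _; exact: normc_ge0.
set w := \sum_i z 0 i.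
have w1 : normc w < 1 by apply: le_lt_trans s1; exact: ler_normc_sum.
pose F (a : multiindex n) := b (mdegree a) * (multinom a)%:R * monomial z a.
pose u := \row_i normc (z 0 i).
have FE a : normc (F a)
    = normc (b (mdegree a)) * (multinom a)%:R * monomial u a.
  by rewrite /F !Normc.normcM normc_nat normc_monomial.
have uE : \sum_i u 0 i = s by apply: eq_bigr => i _; rewrite mxE.
apply/(cvg_normcP (totally_filter (I := multiindex n))) => e e0.
have : (fun K => s ^+ K / (1 - s)) @ \oo --> 0 / (1 - s).
  by apply: cvgMl; apply: cvg_expr; rewrite ger0_norm.
have e20 : 0 < e / 2 by rewrite divr_gt0.
rewrite mul0r => /cvgr_lt /(_ _ e20) [K _ /(_ K (leqnn K)) /= tailK].
exists (indices_below K) => // B /= KB.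
have [N _ NP] := gP w w1 _ e20.
pose L := maxn (maxn K N) (\max_(a <- B) (mdegree a).+1)%N.
have KL : (K <= L)%N by rewrite /L -maxnA leq_maxl.
have NL : (N <= L)%N by rewrite /L leq_max leq_maxr.
have /= := NP L NL; rewrite /psum -sum_multinomial_series -/F => hL.
(* [D] serves to compare [B] with [indices_below L]: the indices added to the latter have zero
   terms, and those added to [B] lie outside [indices_below K]. *)
pose D := (indices_below L `|` B)%fset.
have F0 a : a \in B -> a \notin indices_below L -> F a = 0.
  move=> aB aL; rewrite /F multinom_eq0 ?mulr0 ?mul0r //.
  apply: contra aL => ak; apply: level_indices_below ak _.
  rewrite /L leq_max; apply/orP; right.
  exact: (leq_bigmax_seq (F := fun a : multiindex n => (mdegree a).+1)).
have DE : \sum_(a <- indices_below L) F a = \sum_(a <- D) F a.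
  apply: big_fset_incl => [|a]; first exact: fsubsetUl.
  by rewrite in_fsetU => /orP[-> //|aB aL]; rewrite F0.
have DL : \sum_(a <- indices_below L) normc (F a) = \sum_(a <- D) normc (F a).
  apply: big_fset_incl => [|a]; first exact: fsubsetUl.
  by rewrite in_fsetU => /orP[-> //|aB aL]; rewrite F0 ?Normc.normc0.
have normF N' : \sum_(a <- indices_below N') normc (F a)
    = \sum_(0 <= k < N') normc (b k) * s ^+ k.
  by rewrite -uE -sum_multinomial_series; apply: eq_bigr => a _; rewrite FE.
have hB : normc (\sum_(a <- D) F a - \sum_(a <- B) F a) <= s ^+ K / (1 - s).
  rewrite (bigID (mem B)) /= sum_fset_in ?fsubsetUr // addrAC subrr add0r.
  apply: le_trans (ler_normc_sum _ _ _) _.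
  apply: le_trans (_ : \sum_(a <- D | a \notin indices_below K) normc (F a) <= _).
    rewrite big_mkcond [leRHS]big_mkcond; apply: ler_sum => a _.
    case: ifP => aB; case: ifP => //; rewrite ?normc_ge0 //.
    by move=> /negbFE /(fsubsetP KB); rewrite (negPf aB).
  have := DL; rewrite [X in _ = X -> _](bigID (mem (indices_below K))) /= sum_fset_in; last first.
    by apply: (fsubset_trans (indices_belowS KL)); exact: fsubsetUl.
  rewrite !normF (big_cat_nat (n := K) (p := L)) //= => /addrI <-.
  apply: le_trans (sum_geometric_le K L s0 s1); apply: ler_sum => k _.
  by rewrite -[leRHS]mul1r ler_wpM2r ?exprn_ge0.
have := ler_normcB (g w) (\sum_(a <- D) F a) (\sum_(a <- B) F a).
rewrite /partial_sum -(big_seq_fsetE _ _ xpredT F) /= -DE in hB *.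
lra.
Qed.

End SymmetricSeries.

(** * Moebius transforms of the disc and their Taylor series *)

Section Mobius.
Context {R : realType} (a : R) (a0 : 0 < a) (a1 : a < 1).

Definition mobius (w : R[i]) : R[i] := (a%:C%C - w) / (1 - a%:C%C * w).

Definition mobius_coef (k : nat) : R[i] :=
  if k is j.+1 then - ((1 - a ^+ 2) * a ^+ j)%:C%C else a%:C%C.

Let a_ge0 : 0 <= a := ltW a0.

Let sqr_a1 : 0 <= 1 - a ^+ 2.
Proof. by rewrite subr_ge0 expr_le1 // ltW. Qed.

Lemma normc_mobius_coefS k : normc (mobius_coef k.+1) = (1 - a ^+ 2) * a ^+ k.
Proof. by rewrite normcN normc_real ger0_norm // mulr_ge0 // exprn_ge0. Qed.

Lemma normc_mobius_coef0 : normc (mobius_coef 0) = a.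
Proof. by rewrite normc_real ger0_norm. Qed.

Lemma normc_mobius_coef_le1 k : normc (mobius_coef k) <= 1.
Proof.
case: k => [|k]; first by rewrite normc_mobius_coef0 ltW.
rewrite normc_mobius_coefS mulr_ile1 ?exprn_ge0 ?exprn_ile1 ?(ltW a1) //.
by rewrite gerBl sqr_ge0.
Qed.

Lemma mobius_den_neq0 w : normc w < 1 -> 1 - a%:C%C * w != 0.
Proof.
move=> w1; rewrite subr_eq0 eq_sym; apply/eqP => aw.
have := Normc.normcM a%:C%C w; rewrite aw Normc.normc1 normc_real gtr0_norm // => h.
have : a * normc w <= normc w by rewrite ler_piMl ?normc_ge0 ?ltW.
by rewrite -h leNgt w1.
Qed.

(** It comes from [|1 - a w|^2 - |a - w|^2 = (1 - a^2) (1 - |w|^2)]. *)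
Lemma normc_mobius_le1 w : normc w < 1 -> normc (mobius w) <= 1.
Proof.
move=> w1; rewrite Normc.normcM Normc.normcV ler_pdivrMr; last first.
  rewrite lt_neqAle normc_ge0 andbT eq_sym; apply/eqP => /Normc.eq0_normc.
  by apply/eqP; exact: mobius_den_neq0.
rewrite mul1r; case: w w1 => u v /=; rewrite ?mul0r ?subr0 ?addr0 ?add0r.
rewrite -[X in _ < X -> _]sqrtr1 ltr_sqrt // => uv.
rewrite ler_wsqrtr // -subr_ge0.
have -> : (1 - a * u) ^+ 2 + (- (a * v)) ^+ 2 - ((a - u) ^+ 2 + (- v) ^+ 2)
    = (1 - a ^+ 2) * (1 - (u ^+ 2 + v ^+ 2)) by ring.
by rewrite mulr_ge0 // subr_ge0 ltW.
Qed.

(** Multiplied by the denominator, the partial sums telescope, so the error is explicit. *)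
Lemma mobius_psum_cvg w : normc w < 1 -> forall e : R, 0 < e ->
  \forall K \near \oo, normc (mobius w - psum mobius_coef w K) < e.
Proof.
move=> w1; set d := 1 - a%:C%C * w.
have d0 : d != 0 by exact: mobius_den_neq0.
have psumE K : d * psum mobius_coef w K.+1
    = a%:C%C - w + ((1 - a ^+ 2) * a ^+ K)%:C%C * w ^+ K.+1.
  elim: K => [|K IH].
    rewrite /psum big_nat1 /= !expr0 !mulr1 expr1 /d rmorphB rmorphXn rmorph1 /=.
    ring.
  rewrite /psum big_nat_recr //= mulrDr -/(psum _ _ _) IH /d.
  rewrite !(rmorphM, rmorphB, rmorphXn) rmorph1 /= !exprS; ring.
have err K : mobius w - psum mobius_coef w K.+1
    = - (((1 - a ^+ 2) * a ^+ K)%:C%C * w ^+ K.+1 / d).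
  by apply: (mulfI d0); rewrite mulrBr psumE /mobius -/d; field.
move=> e e0; set r := normc w in w1.
have r0 : 0 <= r by exact: normc_ge0.
have nd : 0 < normc d.
  by rewrite lt_neqAle normc_ge0 andbT eq_sym; apply: contra d0 => /eqP /Normc.eq0_normc ->.
have : (fun K => r ^+ K / normc d) @ \oo --> 0 / normc d.
  by apply: cvgMl; apply: cvg_expr; rewrite ger0_norm.
rewrite mul0r => /cvgr_lt /(_ _ e0) [K _ KP].
exists K.+1 => // -[//|N] KN; have /= := KP N.+1 (ltnW KN); apply: le_lt_trans.
rewrite err normcN !Normc.normcM Normc.normcV normcX -/r normc_real.
rewrite ler_wpM2r ?invr_ge0 ?normc_ge0 // -[leRHS]mul1r ler_wpM2r ?exprn_ge0 //.
rewrite ger0_norm ?mulr_ge0 ?exprn_ge0 //.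
by rewrite mulr_ile1 ?exprn_ge0 ?exprn_ile1 ?(ltW a1) // gerBl sqr_ge0.
Qed.

Lemma holomorphic_mobius_sum n :
  holomorphic_on l1_ball (fun z : 'rV[R[i]]_n => mobius (\sum_i z 0 i)).
Proof.
pose C : numFieldType := R[i].
move=> z zB; have w1 : normc (\sum_i z 0 i) < 1.
  by apply: le_lt_trans zB; exact: ler_normc_sum.
have dsum : differentiable (fun y : 'rV[C]_n => \sum_i y 0 i : C) (z : 'rV[C]_n).
  rewrite (_ : (fun _ => _) = \sum_(i < n) (fun y : 'rV[C]_n => y 0 i : C)).
    by apply: differentiable_sum => i; exact: differentiable_coord.
  by apply/funext => y; rewrite fct_sumE.
apply: (@differentiableM C 'rV[C]_n).
  by apply: differentiableB.
apply: differentiableV; last exact: mobius_den_neq0.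
by apply: differentiableB => //; apply: differentiableM.
Qed.

End Mobius.

(** * The upper bound on admissible points, and the theorem *)

Lemma multinom_mindex0 n : multinom (mindex0 n) = 1%N.
Proof.
have mdeg0 : mdegree (mindex0 n) = 0%N.
  by rewrite /mdegree big1 // => i _; rewrite ffunE.
rewrite /multinom mdeg0 (eq_card (B := predT)) ?card_ffun ?card_ord // => t.
by rewrite !inE; apply/eqP/ffunP => i; rewrite !ffunE eq_card0 // => -[].
Qed.

(** The finite sum over [level_indices m] is a lower bound for the unordered sum, and the
    multinomial formula evaluates it. *)
Lemma esum_symmetric_ge (R : realType) n (c : nat -> R) (r : 'rV[R]_n) m :
  (((c m) * (\sum_i r 0 i) ^+ m)%:E <=
   \esum_(a in [set a : multiindex n | mdegree a = m])
     (c (mdegree a) * (multinom a)%:R * monomial r a)%:E)%E.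
Proof.
apply: esum_ge; exists [set` level_indices m].
  by split=> [|a] /=; [exact: finite_fset|exact: mdegree_level_indices].
rewrite fsbig_finite /= ?set_fsetK; last exact: finite_fset.
rewrite sumEFin lee_fin -multinomial_formula mulr_sumr big_seq [leRHS]big_seq.
by apply: ler_sum => a /mdegree_level_indices ->; rewrite mulrA.
Qed.

(** Admissibility is tested on the Moebius transform of the coordinate sum, with its Bohr sum
    truncated at degree [K]. *)
Lemma admissible_mobius_le (R : realType) n (p a : R) (r : 'rV[R]_n) K :
  0 < a -> a < 1 -> bohr_admissible p r ->
  a `^ p + \sum_(k < K) (1 - a ^+ 2) * a ^+ k * (\sum_i r 0 i) ^+ k.+1 <= 1.
Proof.
move=> a0 a1 [r0 adm].
pose f (z : 'rV[R[i]]_n) := mobius a (\sum_i z 0 i).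
have f1 : (sup_norm f <= 1)%E.
  apply: ge_ereal_sup => _ [z zB <-]; rewrite lee_fin normc_mobius_le1 //.
  by apply: le_lt_trans zB; exact: ler_normc_sum.
have /(_ f1) := adm _ _ (holomorphic_mobius_sum a0 a1 (n := n))
  (symmetric_monomial_coefficients (normc_mobius_coef_le1 a0 a1) (mobius_psum_cvg a0 a1)).
move/le_trans => /(_ _ f1); rewrite -lee_fin; apply: le_trans.
rewrite EFinD /bohr_sum; apply: leeD.
  rewrite multinom_mindex0 mulr1 /mdegree big1 => [|i _]; last by rewrite ffunE.
  by rewrite normc_mobius_coef0.
have mon_ge0 (b : multiindex n) : 0 <= monomial r b.
  by rewrite prodr_ge0 // => i _; rewrite exprn_ge0.
apply: le_trans (nneseries_lim_ge K.+1 _); last first.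
  by move=> m _ _; apply: esum_ge0 => b _; rewrite lee_fin mulr_ge0 ?normc_ge0.
rewrite big_add1 /= big_mkord -sumEFin; apply: lee_sum => k _.
rewrite -(normc_mobius_coefS a0 a1).
apply: le_trans (esum_symmetric_ge (fun m => normc (mobius_coef a m)) r k.+1) _.
apply: le_esum => b _.
by rewrite Normc.normcM normc_nat.
Qed.

(** Dividing the Moebius inequality by [1 - a] and letting [a] tend to 1 bounds the partial sums of
    [S^m], [m >= 1], by [p / 2]. This is the full geometric sum at [s = p / (p + 2)], so
    [S <= s]. *)
Lemma admissible_sum_le (R : realType) n (p : R) (r : 'rV[R]_n) :
  1 <= p -> bohr_admissible p r -> \sum_i r 0 i <= p / (p + 2).
Proof.
move=> p1 adm; set S := \sum_i r 0 i.
have S0 : 0 <= S by apply: sumr_ge0 => i _; case: adm.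
have S_le K : \sum_(k < K) S ^+ k.+1 <= p / 2.
  (* The factor [1 + 'X] is left from [1 - a^2] after division by [1 - a]; Bernoulli bounds
     [1 - a^p] by [p (1 - a)]. *)
  pose P := (1 + 'X) * \sum_(k < K) S ^+ k.+1 *: 'X^k.
  have PE a : P.[a] = (1 + a) * \sum_(k < K) S ^+ k.+1 * a ^+ k.
    rewrite /P !hornerE horner_sum; congr (_ * _).
    by apply: eq_bigr => k _; rewrite !hornerE.
  have : P.[1] <= p.
    apply: horner1_le => a a0 a1.
    have := admissible_mobius_le K a0 a1 adm.
    have := bernoulli_powR (ltW a0) p1.
    have -> : \sum_(k < K) (1 - a ^+ 2) * a ^+ k * S ^+ k.+1 = (1 - a) * P.[a].
      rewrite PE mulrA mulr_sumr; apply: eq_bigr => k _; ring.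
    by move=> bern adm_a; rewrite -(ler_pM2l (x := 1 - a)) ?subr_gt0 //; lra.
  rewrite PE; under eq_bigr do rewrite expr1n mulr1.
  by lra.
rewrite leNgt; apply/negP => sS; set s := p / (p + 2) in sS.
have s0 : 0 <= s by rewrite divr_ge0 //; lra.
have s1 : s < 1 by rewrite ltr_pdivrMr; lra.
have sE : p / 2 * (1 - s) = s by rewrite /s; field; lra.
have geom K : \sum_(k < K) s ^+ k.+1 = p / 2 * (1 - s ^+ K).
  elim: K => [|K IH]; first by rewrite big_ord0 expr0 subrr mulr0.
  by rewrite big_ord_recr /= IH exprSr -{3}sE; ring.
(* If [S > s], every power of [S] dominates that of [s], so the first terms alone differ by at most
   what the partial sum at [s] falls short of [p / 2]. *)
have gap K : S - s <= p / 2 * s ^+ K.+1.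
  have := S_le K.+1; have := geom K.+1.
  rewrite !big_ord_recl !expr1 => h1 h2.
  have : \sum_(i < K) s ^+ (bump 0 i).+1 <= \sum_(i < K) S ^+ (bump 0 i).+1.
    by apply: ler_sum => i _; rewrite ler_pXn2r ?nnegrE // ltW.
  by rewrite /= in h1 h2 *; lra.
have : (fun K => p / 2 * s ^+ K) @ \oo --> p / 2 * 0.
  by apply: cvgMr; apply: cvg_expr; rewrite ger0_norm.
rewrite mulr0 => lim0; have : S - s <= 0.
  apply: (cvgr_to_ge lim0).
  by exists 1%N => // -[//|K] _; exact: gap.
by rewrite leNgt subr_gt0 sS.
Qed.

Theorem corollary2p9 (R : realType) (n : nat) (p : R) :
  (0 < n)%N -> 1 <= p -> p <= 2 ->
  arithmetic_bohr_radius n p = (p / (n%:R * (p + 2)))%:E.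
Proof.
move=> n0 p1 p2.
have -> : p / (n%:R * (p + 2)) = p / (p + 2) / n%:R by rewrite invfM mulrCA mulrC.
apply/eqP; rewrite eq_le; apply/andP; split.
  apply: ge_ereal_sup => _ [r adm <-].
  by rewrite lee_fin ler_wpM2r ?invr_ge0 // admissible_sum_le.
(* The supremum is attained, at a point on the first axis. *)
apply: ereal_sup_ubound; pose i0 := Ordinal n0.
exists (axis_point i0 (p / (p + 2))); first exact: axis_point_admissible.
by have /= -> := sum_axis_point i0 (h := id) (p / (p + 2)) erefl.
Qed.
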